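(* Let $n\in\mathbb{N}$. Every theorem of $\mathit{I\Sigma}_{n+1}$ is provable in $\mathsf{S}_n$; that is, if $\mathit{I\Sigma}_{n+1}\vdash\varphi$, then there is a regular $\Pi_{n+1}$-restricted $\infty$-proof whose root is marked by the sequent $\{\varphi\}$.
   Context: **Formulas and sequents.** Arithmetical terms are built from individual variables $\mathit{Var}=\{x_0,x_1,\dots\}$ and the constant $0$ by the unary symbol $s$ and the binary symbols $+,\cdot$. Arithmetical formulas are given by $\varphi::=t=t\mid t\neq t\mid(\varphi\wedge\varphi)\mid(\varphi\vee\varphi)\mid\forall y\,\varphi\mid\exists y\,\varphi$. Negation $\overline{\varphi}$ is the syntactic operation swapping $=$ with $\neq$, $\wedge$ with $\vee$, $\forall$ with $\exists$ (so $\overline{\overline\varphi}=\varphi$). Put $\bot:=0\neq 0$, $\varphi\to\psi:=\overline\varphi\vee\psi$. $x\leq y$ abbreviates $\exists z\,(z+x=y)$. $\varphi[y\mapsto t]$ is the substitution of $t$ for all free occurrences of $y$ (no variable of $t$ may become bound). A sequent is a finite multiset of formulas, interpreted as $\bigvee\Gamma$ (with $\bigvee\emptyset:=\bot$); the comma denotes multiset union. $\mathit{FV}$ denotes the set of free variables. **Classes.** Bounded quantifiers: $\forall y\leq t\,\varphi:=\forall y(y\leq t\to\varphi)$, $\exists y\leq t\,\varphi:=\exists y(y\leq t\wedge\varphi)$, with $y$ not in $t$. $\Delta_0=\Sigma_0=\Pi_0$ is the set of formulas built from atomic formulas by logical connectives and bounded quantifiers only. A formula is $\Sigma_{n+1}$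 (resp. $\Pi_{n+1}$) if it is obtained from $\Pi_n$ (resp. $\Sigma_n$) formulas using existential (resp. universal) quantifiers and $\wedge,\vee$. **Theories.** Robinson's arithmetic $\mathsf{Q}$: first-order logic with equality plus (universal closures of) $\neg s(x)=0$; $s(x)=s(y)\to x=y$; $x=0\vee\exists y\,x=s(y)$; $x+0=x$; $x+s(y)=s(x+y)$; $x\cdot0=0$; $x\cdot s(y)=x\cdot y+x$. $\mathit{I\Sigma}_n$ is $\mathsf{Q}$ plus the induction schema $\varphi(0)\wedge\forall x(\varphi(x)\to\varphi(s(x)))\to\forall x\,\varphi(x)$ for all $\Sigma_n$ formulas $\varphi$ (possibly with other free variables). **Calculus $\mathsf{SQ}$.** Initial sequents: $\Gamma,t_0=t_1,t_0\neq t_1$ and $\Gamma,s(t)\neq0$. Rules (premisses / conclusion): $(\wedge)$: $\Gamma,\varphi$ and $\Gamma,\psi$ / $\Gamma,\varphi\wedge\psi$; $(\vee)$: $\Gamma,\varphi,\psi$ / $\Gamma,\varphi\vee\psi$; $(\forall)$: $\Gamma,\varphi[y\mapsto z]$ / $\Gamma,\forall y\,\varphi$, where $z\notin\mathit{FV}(\Gamma,\forall y\,\varphi)$ ($z$ is the active variable); $(\exists)$: $\Gamma,\varphi[y\mapsto t],\exists y\,\varphi$ / $\Gamma,\exists y\,\varphi$; $(\mathsf{ref})$: $\Gamma,t\neq t$ / $\Gamma$; $(\mathsf{rep})$: $\Gamma,t_0\neq t_1,(u_0\neq u_1)[y\mapsto t_0],(u_0\neq u_1)[y\mapsto t_1]$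 / $\Gamma,t_0\neq t_1,(u_0\neq u_1)[y\mapsto t_0]$; $(\mathsf{add}_0)$: $\Gamma,t+0\neq t$ / $\Gamma$; $(\mathsf{add}_s)$: $\Gamma,t+s(u)\neq s(t+u)$ / $\Gamma$; $(\mathsf{mult}_0)$: $\Gamma,t\cdot0\neq0$ / $\Gamma$; $(\mathsf{mult}_s)$: $\Gamma,t\cdot s(u)\neq t\cdot u+t$ / $\Gamma$; $(\mathsf{pred})$: $\Gamma,s(t_0)\neq s(t_1),t_0\neq t_1$ / $\Gamma,s(t_0)\neq s(t_1)$; $(\mathsf{case})$: left premiss $\Gamma[y\mapsto0]$ and right premiss $\Gamma[y\mapsto s(y)]$ / $\Gamma$, where $y\in\mathit{FV}(\Gamma)$ ($y$ is the active variable); $(\mathsf{weak})$: $\Gamma$ / $\Gamma,\Delta$; $(\mathsf{cut})$: left premiss $\Gamma,\varphi$ and right premiss $\Gamma,\overline\varphi$ / $\Gamma$. **$\infty$-proofs.** An $\infty$-proof is a possibly infinite tree whose nodes are marked by sequents, constructed according to the rules of $\mathsf{SQ}$, with every leaf marked by an initial sequent, such that every infinite branch has a tail satisfying: (a) the tail does not pass through left premisses of $(\mathsf{case})$; (b) if the tail passes through the right premiss $\Gamma[z\mapsto s(z)]$ of $(\mathsf{case})$, then after that application the tail does not intersect applications of $(\forall)$ with active variable $z$; (c) for some variable $y$, the tail passes through the right premiss of $(\mathsf{case})$ with active variable $y$ infinitely many times. An $\infty$-proof is $\Pi_m$-restricted if every infinite branch has a tail satisfying (a)–(c) and: (d) if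 the tail passes through the left (right) premiss of $(\wedge)$, then $\varphi$ ($\psi$) is in $\Pi_m$; (e) if the tail intersects an application of $(\forall)$, then $\varphi[y\mapsto z]\in\Pi_m$; (f) if the tail passes through the left (right) premiss of $(\mathsf{cut})$, then $\varphi$ ($\overline\varphi$) is in $\Pi_m$; (g) if the tail passes through the right premiss $\Gamma[z\mapsto s(z)]$ of $(\mathsf{case})$, then $z$ occurs freely only in $\Pi_m$-formulas of $\Gamma$. An $\infty$-proof is regular if it contains only finitely many non-isomorphic subtrees with respect to the marking of sequents. *)

(* Defs.v *)
From HB Require Import structures.
From mathcomp Require Export all_boot.
From mathcomp Require Export finmap multiset.

Set Implicit Arguments.
Unset Strict Implicit.
Unset Printing Implicit Defensive.

Local Open Scope nat_scope.
Local Open Scope mset_scope.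

(* Variables are natural numbers: Var i is x_i. *)

Inductive term : Type :=
  | Var of nat
  | Zero
  | Succ of term
  | Add of term & term
  | Mul of term & term.

Inductive formula : Type :=
  | Eq of term & term
  | Neq of term & term
  | And of formula & formula
  | Or of formula & formula
  | All of nat & formula
  | Ex of nat & formula.

(* Encodings into generic trees give the choiceType structures that
   {mset formula} requires. *)

Fixpoint term_enc (t : term) : GenTree.tree nat :=
  match t with
  | Var x => GenTree.Leaf x
  | Zero => GenTree.Node 0 [::]
  | Succ u => GenTree.Node 1 [:: term_enc u]
  | Add u v => GenTree.Node 2 [:: term_enc u; term_enc v]
  | Mul u v => GenTree.Node 3 [:: term_enc u; term_enc v]
  end.

Fixpoint term_dec (g : GenTree.tree nat) : term :=
  match g with
  | GenTree.Leaf x => Var x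
  | GenTree.Node 1 [:: u] => Succ (term_dec u)
  | GenTree.Node 2 [:: u; v] => Add (term_dec u) (term_dec v)
  | GenTree.Node 3 [:: u; v] => Mul (term_dec u) (term_dec v)
  | _ => Zero
  end.

Lemma term_encK : cancel term_enc term_dec.
Proof. by elim=> //= [t ->|t -> u ->|t -> u ->]. Qed.

HB.instance Definition _ := Countable.copy term (can_type term_encK).

Fixpoint formula_enc (phi : formula) : GenTree.tree (term + nat) :=
  match phi with
  | Eq t u => GenTree.Node 0 [:: GenTree.Leaf (inl t); GenTree.Leaf (inl u)]
  | Neq t u => GenTree.Node 1 [:: GenTree.Leaf (inl t); GenTree.Leaf (inl u)]
  | And a b => GenTree.Node 2 [:: formula_enc a; formula_enc b]
  | Or a b => GenTree.Node 3 [:: formula_enc a; formula_enc b]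
  | All y a => GenTree.Node 4 [:: GenTree.Leaf (inr y); formula_enc a]
  | Ex y a => GenTree.Node 5 [:: GenTree.Leaf (inr y); formula_enc a]
  end.

Fixpoint formula_dec (g : GenTree.tree (term + nat)) : formula :=
  match g with
  | GenTree.Node 0 [:: GenTree.Leaf (inl t); GenTree.Leaf (inl u)] => Eq t u
  | GenTree.Node 1 [:: GenTree.Leaf (inl t); GenTree.Leaf (inl u)] => Neq t u
  | GenTree.Node 2 [:: a; b] => And (formula_dec a) (formula_dec b)
  | GenTree.Node 3 [:: a; b] => Or (formula_dec a) (formula_dec b)
  | GenTree.Node 4 [:: GenTree.Leaf (inr y); a] => All y (formula_dec a)
  | GenTree.Node 5 [:: GenTree.Leaf (inr y); a] => Ex y (formula_dec a)
  | _ => Eq Zero Zero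
  end.

Lemma formula_encK : cancel formula_enc formula_dec.
Proof. by elim=> //= [a -> b ->|a -> b ->|y a ->|y a ->]. Qed.

HB.instance Definition _ := Countable.copy formula (can_type formula_encK).

Fixpoint neg (phi : formula) : formula :=
  match phi with
  | Eq t u => Neq t u
  | Neq t u => Eq t u
  | And a b => Or (neg a) (neg b)
  | Or a b => And (neg a) (neg b)
  | All y a => Ex y (neg a)
  | Ex y a => All y (neg a)
  end.

Definition bot : formula := Neq Zero Zero.
Definition imp (phi psi : formula) : formula := Or (neg phi) psi.

Fixpoint tvars (t : term) : seq nat :=
  match t with
  | Var x => [:: x]
  | Zero => [::]
  | Succ u => tvars u
  | Add u v | Mul u v => tvars u ++ tvars v
  end.

Fixpoint fv (phi : formula) : seq nat :=
  match phi with
  | Eq t u | Neq t u => tvars t ++ tvars u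
  | And a b | Or a b => fv a ++ fv b
  | All y a | Ex y a => [seq x <- fv a | x != y]
  end.

Fixpoint tsubst (y : nat) (t : term) (u : term) : term :=
  match u with
  | Var x => if x == y then t else Var x
  | Zero => Zero
  | Succ v => Succ (tsubst y t v)
  | Add v w => Add (tsubst y t v) (tsubst y t w)
  | Mul v w => Mul (tsubst y t v) (tsubst y t w)
  end.

(* subst y t phi is phi[y |-> t] only when no variable of t becomes bound,
   that is, when free_for y t phi holds. *)
Fixpoint subst (y : nat) (t : term) (phi : formula) : formula :=
  match phi with
  | Eq u v => Eq (tsubst y t u) (tsubst y t v)
  | Neq u v => Neq (tsubst y t u) (tsubst y t v)
  | And a b => And (subst y t a) (subst y t b)
  | Or a b => Or (subst y t a) (subst y t b)
  | All x a => if x == y then All x a else All x (subst y t a)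
  | Ex x a => if x == y then Ex x a else Ex x (subst y t a)
  end.

Fixpoint free_for (y : nat) (t : term) (phi : formula) : bool :=
  match phi with
  | Eq _ _ | Neq _ _ => true
  | And a b | Or a b => free_for y t a && free_for y t b
  | All x a | Ex x a =>
      (y \notin fv phi) || (x \notin tvars t) && free_for y t a
  end.

(* t <= u, with z the bound variable of the abbreviation *)
Definition leq_fml (z : nat) (t u : term) : formula :=
  Ex z (Eq (Add (Var z) t) u).

Inductive Delta0 : formula -> Prop :=
  | Delta0_Eq t u : Delta0 (Eq t u)
  | Delta0_Neq t u : Delta0 (Neq t u)
  | Delta0_And phi psi : Delta0 phi -> Delta0 psi -> Delta0 (And phi psi)
  | Delta0_Or phi psi : Delta0 phi -> Delta0 psi -> Delta0 (Or phi psi)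
  | Delta0_All y z t phi :
      y \notin tvars t -> z \notin y :: tvars t -> Delta0 phi ->
      Delta0 (All y (imp (leq_fml z (Var y) t) phi))
  | Delta0_Ex y z t phi :
      y \notin tvars t -> z \notin y :: tvars t -> Delta0 phi ->
      Delta0 (Ex y (And (leq_fml z (Var y) t) phi)).

Inductive ex_closure (C : formula -> Prop) : formula -> Prop :=
  | ex_base phi : C phi -> ex_closure C phi
  | ex_And phi psi :
      ex_closure C phi -> ex_closure C psi -> ex_closure C (And phi psi)
  | ex_Or phi psi :
      ex_closure C phi -> ex_closure C psi -> ex_closure C (Or phi psi)
  | ex_Ex y phi : ex_closure C phi -> ex_closure C (Ex y phi).

Inductive all_closure (C : formula -> Prop) : formula -> Prop :=
  | all_base phi : C phi -> all_closure C phi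
  | all_And phi psi :
      all_closure C phi -> all_closure C psi -> all_closure C (And phi psi)
  | all_Or phi psi :
      all_closure C phi -> all_closure C psi -> all_closure C (Or phi psi)
  | all_All y phi : all_closure C phi -> all_closure C (All y phi).

Fixpoint Sigma (n : nat) : formula -> Prop :=
  if n is m.+1 then ex_closure (Pi m) else Delta0
with Pi (n : nat) : formula -> Prop :=
  if n is m.+1 then all_closure (Sigma m) else Delta0.

(* First-order logic with equality: natural deduction from the axioms T under
   the open assumptions G.  Since neg is an involution on formulas,
   nd_RAA also gives negation introduction. *)
Inductive nd (T : formula -> Prop) : seq formula -> formula -> Prop :=
  | nd_axiom G phi : T phi -> nd T G phi
  | nd_assume G phi : phi \in G -> nd T G phi
  | nd_AndI G phi psi : nd T G phi -> nd T G psi -> nd T G (And phi psi)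
  | nd_AndEl G phi psi : nd T G (And phi psi) -> nd T G phi
  | nd_AndEr G phi psi : nd T G (And phi psi) -> nd T G psi
  | nd_OrIl G phi psi : nd T G phi -> nd T G (Or phi psi)
  | nd_OrIr G phi psi : nd T G psi -> nd T G (Or phi psi)
  | nd_OrE G phi psi chi :
      nd T G (Or phi psi) -> nd T (phi :: G) chi -> nd T (psi :: G) chi ->
      nd T G chi
  | nd_AllI G y phi z :
      z \notin fv (All y phi) -> (forall psi, psi \in G -> z \notin fv psi) ->
      free_for y (Var z) phi ->
      nd T G (subst y (Var z) phi) -> nd T G (All y phi)
  | nd_AllE G y phi t :
      free_for y t phi -> nd T G (All y phi) -> nd T G (subst y t phi)
  | nd_ExI G y phi t :
      free_for y t phi -> nd T G (subst y t phi) -> nd T G (Ex y phi)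
  | nd_ExE G y phi z chi :
      z \notin fv (Ex y phi) -> z \notin fv chi ->
      (forall psi, psi \in G -> z \notin fv psi) ->
      free_for y (Var z) phi ->
      nd T G (Ex y phi) -> nd T (subst y (Var z) phi :: G) chi ->
      nd T G chi
  | nd_negE G phi : nd T G phi -> nd T G (neg phi) -> nd T G bot
  | nd_RAA G phi : nd T (neg phi :: G) bot -> nd T G phi
  | nd_refl G t : nd T G (Eq t t)
  | nd_leibniz G y phi t u :
      free_for y t phi -> free_for y u phi ->
      nd T G (Eq t u) -> nd T G (subst y t phi) -> nd T G (subst y u phi).

Definition provable (T : formula -> Prop) (phi : formula) : Prop :=
  nd T [::] phi.

Definition univ_closure (phi : formula) : formula :=
  foldr All phi (undup (fv phi)).

Inductive Q_axiom : formula -> Prop :=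
  | Q_succ_neq0 : Q_axiom (neg (Eq (Succ (Var 0)) Zero))
  | Q_succ_inj :
      Q_axiom (imp (Eq (Succ (Var 0)) (Succ (Var 1))) (Eq (Var 0) (Var 1)))
  | Q_case :
      Q_axiom (Or (Eq (Var 0) Zero) (Ex 1 (Eq (Var 0) (Succ (Var 1)))))
  | Q_add0 : Q_axiom (Eq (Add (Var 0) Zero) (Var 0))
  | Q_addS :
      Q_axiom (Eq (Add (Var 0) (Succ (Var 1))) (Succ (Add (Var 0) (Var 1))))
  | Q_mul0 : Q_axiom (Eq (Mul (Var 0) Zero) Zero)
  | Q_mulS :
      Q_axiom (Eq (Mul (Var 0) (Succ (Var 1)))
                  (Add (Mul (Var 0) (Var 1)) (Var 0))).

Definition induction (x : nat) (phi : formula) : formula :=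
  imp (And (subst x Zero phi) (All x (imp phi (subst x (Succ (Var x)) phi))))
      (All x phi).

Inductive ISigma (n : nat) : formula -> Prop :=
  | ISigma_Q phi : Q_axiom phi -> ISigma n (univ_closure phi)
  | ISigma_induction x phi :
      Sigma n phi -> ISigma n (univ_closure (induction x phi)).

Definition sequent := {mset formula}.

Definition seq_subst (y : nat) (t : term) (G : sequent) : sequent :=
  seq_mset [seq subst y t phi | phi <- enum_mset G].

Definition in_fv (x : nat) (G : sequent) : Prop :=
  exists2 phi, phi \in G & x \in fv phi.

(* Instances of the initial sequents and of the rules of SQ, with all the data
   that determines the conclusion, the premisses and the active variable. *)
Inductive rule : Type :=
  | InitEq of sequent & term & term
  | InitSucc of sequent & term
  | RAnd of sequent & formula & formula
  | ROr of sequent & formula & formula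
  | RAll (G : sequent) (y : nat) (phi : formula) (z : nat)
  | REx (G : sequent) (y : nat) (phi : formula) (t : term)
  | RRef of sequent & term
  | RRep (G : sequent) (t0 t1 : term) (y : nat) (u0 u1 : term)
  | RAdd0 of sequent & term
  | RAddS of sequent & term & term
  | RMult0 of sequent & term
  | RMultS of sequent & term & term
  | RPred of sequent & term & term
  | RCase of sequent & nat
  | RWeak of sequent & sequent
  | RCut of sequent & formula.

Definition conclusion (r : rule) : sequent :=
  match r with
  | InitEq G t0 t1 => G `+` [mset Eq t0 t1; Neq t0 t1]
  | InitSucc G t => G `+` [mset Neq (Succ t) Zero]
  | RAnd G phi psi => G `+` [mset And phi psi]
  | ROr G phi psi => G `+` [mset Or phi psi]
  | RAll G y phi z => G `+` [mset All y phi]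
  | REx G y phi t => G `+` [mset Ex y phi]
  | RRef G t => G
  | RRep G t0 t1 y u0 u1 => G `+` [mset Neq t0 t1; subst y t0 (Neq u0 u1)]
  | RAdd0 G t => G
  | RAddS G t u => G
  | RMult0 G t => G
  | RMultS G t u => G
  | RPred G t0 t1 => G `+` [mset Neq (Succ t0) (Succ t1)]
  | RCase G y => G
  | RWeak G D => G `+` D
  | RCut G phi => G
  end.

Definition premisses (r : rule) : seq sequent :=
  match r with
  | InitEq G t0 t1 => [::]
  | InitSucc G t => [::]
  | RAnd G phi psi => [:: G `+` [mset phi]; G `+` [mset psi]]
  | ROr G phi psi => [:: G `+` [mset phi; psi]]
  | RAll G y phi z => [:: G `+` [mset subst y (Var z) phi]]
  | REx G y phi t => [:: G `+` [mset subst y t phi; Ex y phi]]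
  | RRef G t => [:: G `+` [mset Neq t t]]
  | RRep G t0 t1 y u0 u1 =>
      [:: G `+` [mset Neq t0 t1; subst y t0 (Neq u0 u1);
                      subst y t1 (Neq u0 u1)]]
  | RAdd0 G t => [:: G `+` [mset Neq (Add t Zero) t]]
  | RAddS G t u => [:: G `+` [mset Neq (Add t (Succ u)) (Succ (Add t u))]]
  | RMult0 G t => [:: G `+` [mset Neq (Mul t Zero) Zero]]
  | RMultS G t u => [:: G `+` [mset Neq (Mul t (Succ u)) (Add (Mul t u) t)]]
  | RPred G t0 t1 => [:: G `+` [mset Neq (Succ t0) (Succ t1); Neq t0 t1]]
  | RCase G y => [:: seq_subst y Zero G; seq_subst y (Succ (Var y)) G]
  | RWeak G D => [:: G]
  | RCut G phi => [:: G `+` [mset phi]; G `+` [mset neg phi]]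
  end.

Definition side_condition (r : rule) : Prop :=
  match r with
  | RAll G y phi z =>
      ~ in_fv z (G `+` [mset All y phi]) /\ free_for y (Var z) phi
  | REx G y phi t => free_for y t phi
  | RCase G y => in_fv y G
  | _ => True
  end.

(* A tree is given by its nodes, addressed by the sequence of premiss indices
   leading to them from the root (0 is the only or the left premiss, 1 the
   right one); None stands for the absence of a node.  The sequent marking a
   node is the conclusion of the rule instance stored there. *)
Definition tree := seq nat -> option rule.

Definition marking (p : tree) (a : seq nat) : option sequent :=
  omap conclusion (p a).

Definition is_derivation (p : tree) : Prop :=
  [/\ p [::] <> None,
      forall a r, p a = Some r -> side_condition r
    & forall a i,
        marking p (rcons a i) = obind (fun r => onth (premisses r) i) (p a)].

Definition is_branch (p : tree) (b : nat -> nat) : Prop :=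
  forall k, p (mkseq b k) <> None.

(* the branch b meets r at height k, then goes through premiss i of r *)
Definition passes (p : tree) (b : nat -> nat) (k : nat) (r : rule) (i : nat)
  : Prop := p (mkseq b k) = Some r /\ b k = i.

(* Conditions (a), (b), (c) on the tail of b starting at height m *)
Definition progressing_tail (p : tree) (b : nat -> nat) (m : nat) : Prop :=
  [/\ forall k G y, m <= k -> ~ passes p b k (RCase G y) 0,
      forall k G z, m <= k -> passes p b k (RCase G z) 1 ->
        forall j D y phi, k < j -> p (mkseq b j) <> Some (RAll D y phi z)
    & exists y, forall N, exists k G,
        [/\ m <= k, N <= k & passes p b k (RCase G y) 1]].

(* Conditions (d), (e), (f), (g) on the tail of b starting at height m *)
Definition Pi_tail (l : nat) (p : tree) (b : nat -> nat) (m : nat) : Prop :=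
  forall k, m <= k ->
  [/\ forall G phi psi,
        (passes p b k (RAnd G phi psi) 0 -> Pi l phi) /\
        (passes p b k (RAnd G phi psi) 1 -> Pi l psi),
      forall G y phi z,
        p (mkseq b k) = Some (RAll G y phi z) -> Pi l (subst y (Var z) phi),
      forall G phi,
        (passes p b k (RCut G phi) 0 -> Pi l phi) /\
        (passes p b k (RCut G phi) 1 -> Pi l (neg phi))
    & forall G z, passes p b k (RCase G z) 1 ->
        forall phi, phi \in G -> z \in fv phi -> Pi l phi].

Definition inf_proof (p : tree) : Prop :=
  is_derivation p /\
  forall b, is_branch p b -> exists m, progressing_tail p b m.

Definition Pi_restricted (l : nat) (p : tree) : Prop :=
  forall b, is_branch p b ->
    exists m, progressing_tail p b m /\ Pi_tail l p b m.

(* Every subtree has the same nodes and the same sequents as one of finitely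
   many subtrees; the rule instances need not agree. *)
Definition regular (p : tree) : Prop :=
  exists s : seq (seq nat),
    forall a, p a <> None ->
      exists2 c, c \in s & forall d, marking p (a ++ d) = marking p (c ++ d).

Definition S_provable (n : nat) (phi : formula) : Prop :=
  exists p : tree,
    [/\ inf_proof p, Pi_restricted n.+1 p, regular p
      & marking p [::] = Some [mset phi]].

(* Main.v *)
(* Natural deduction is simulated in SQ by means of cuts, so only the axioms need
   attention.  Induction for a Pi_{n+1} formula phi comes from a proof with one
   cycle: apply (case) to Gamma, phi(x); the right premiss Gamma, phi(s x) is cut
   with phi(x), and the left premiss Gamma, phi(s x), phi(x) of the cut weakens to
   the root Gamma, phi(x).  The only infinite branch of the cycle goes through a
   right premiss of (case) once per turn, and its cuts are on the Pi_{n+1} formula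
   phi(x).  Induction for a Sigma_{n+1} formula phi reduces to it, applied in the
   variable k to forall x (x + k = a -> ~ phi(x)). *)

Require Import Defs.
From Stdlib Require Import Classical.
From mathcomp Require Import zify.

Set Implicit Arguments.
Unset Strict Implicit.
Unset Printing Implicit Defensive.

Local Open Scope nat_scope.
Local Open Scope mset_scope.

(** * Branches and trees *)

Lemma mkseqD (T : Type) (f : nat -> T) m n :
  mkseq f (m + n) = mkseq f m ++ mkseq (fun j => f (m + j)) n.
Proof.
by rewrite /mkseq iotaD map_cat add0n -[X in iota X n]addn0 iotaDl -map_comp.
Qed.

Definition branch_step (p : tree) (b : nat -> nat) (k : nat) :
  option rule * nat := (p (mkseq b k), b k).

Definition restricted_branch (l : nat) (p : tree) (b : nat -> nat) : Prop :=
  exists m, progressing_tail p b m /\ Pi_tail l p b m.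

Lemma restricted_branch_suffix l p q b b' k :
    (forall j, branch_step p b (k + j) = branch_step q b' j) ->
  restricted_branch l q b' -> restricted_branch l p b.
Proof.
move=> stepE [m [[no_left no_All [y right_y]] Pi_m]].
have nodeE j : p (mkseq b (k + j)) = q (mkseq b' j) by case: (stepE j).
have passesE j r i : passes p b (k + j) r i <-> passes q b' j r i.
  by rewrite /passes nodeE; case: (stepE j) => _ ->.
have unshift j : k + m <= j -> exists2 i, j = k + i & m <= i.
  by move=> kmj; exists (j - k); lia.
exists (k + m); split; first split.
- by move=> _ G z /unshift[j -> mj] /passesE; apply: no_left.
- move=> _ G z /unshift[j -> mj] /passesE right_z i D w phi ji.
  have /unshift[i' i'E _] : k + m <= i by lia.
  by rewrite i'E nodeE; apply: no_All right_z _ _ _ _ _; lia.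
- exists y => N; have [j [G [mj Nj right_j]]] := right_y N.
  by exists (k + j), G; split; [lia | lia | apply/passesE].
- move=> _ /unshift[j -> /Pi_m[Pi_And Pi_All Pi_cut Pi_case]]; split.
  + by move=> G phi psi; split=> /passesE; apply Pi_And.
  + by move=> G z phi w; rewrite nodeE; apply: Pi_All.
  + by move=> G phi; split=> /passesE; apply Pi_cut.
  + by move=> G z /passesE; apply: Pi_case.
Qed.

Lemma restricted_branch_subtree l p q b k :
    (forall a, p (mkseq b k ++ a) = q a) -> Pi_restricted l q ->
  is_branch p b -> restricted_branch l p b.
Proof.
move=> pq q_restricted pb; pose b' j := b (k + j).
have nodeE j : p (mkseq b (k + j)) = q (mkseq b' j) by rewrite mkseqD pq.
apply: (@restricted_branch_suffix l p q b b' k) => [j|].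
  by rewrite /branch_step nodeE.
by apply: q_restricted => j; rewrite -nodeE.
Qed.

Section PeriodicTrees.

Definition periodic_branch (c : seq nat) (j : nat) : nat :=
  nth 0 c (j %% size c).

Lemma mkseq_periodic_branch c r :
  r <= size c -> mkseq (periodic_branch c) r = take r c.
Proof.
move=> rc; apply: (@eq_from_nth _ 0) => [|i]; rewrite size_mkseq ?size_takel //.
by move=> ir; rewrite nth_mkseq // nth_take // /periodic_branch modn_small; lia.
Qed.

Variables (p : tree) (c : seq nat).
Hypotheses (c_gt0 : 0 < size c) (periodic : forall a, p (c ++ a) = p a).

Lemma periodic_node j a :
  p (mkseq (periodic_branch c) j ++ a) = p (take (j %% size c) c ++ a).
Proof.
rewrite {1}(divn_eq j (size c)); elim: (j %/ size c) => [|q IH].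
  by rewrite mkseq_periodic_branch // ltnW ?ltn_pmod.
rewrite mulSn -addnA mkseqD mkseq_periodic_branch // take_size -catA periodic -IH.
by congr (p (_ ++ a)); apply: eq_mkseq => i; rewrite /periodic_branch modnDl.
Qed.

(* Every other branch leaves the periodic one at some node, and proceeds in one
   of the subtrees that hang off the first period. *)
Lemma periodic_Pi_restricted l :
    restricted_branch l p (periodic_branch c) ->
    (forall k i, k < size c -> i != nth 0 c k ->
       Pi_restricted l (fun a => p (take k c ++ i :: a))) ->
  Pi_restricted l p.
Proof.
move=> cycle off_cycle b pb; have [bE|] := classic (b =1 periodic_branch c).
  apply: (@restricted_branch_suffix _ _ _ _ _ 0) cycle => j.
  by rewrite /branch_step bE (eq_mkseq bE).
move/not_all_ex_not=> [j0 /eqP bj0].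
have leaves : exists j, b j != periodic_branch c j by exists j0.
have [j bj j_min] := ex_minnP leaves.
have bjE : mkseq b j = mkseq (periodic_branch c) j.
  apply/eq_in_map => i; rewrite mem_iota => /= ij; apply/eqP/negPn/negP => /j_min.
  by lia.
apply: (restricted_branch_subtree (k := j.+1)) (off_cycle _ _ _ bj) pb.
  by move=> a; rewrite mkseqS -cats1 -catA bjE periodic_node.
exact: ltn_pmod.
Qed.

End PeriodicTrees.

Definition locally_correct (p : tree) : Prop :=
  (forall a r, p a = Some r -> side_condition r) /\
  (forall a i,
     marking p (rcons a i) = obind (fun r => onth (premisses r) i) (p a)).

(* root = None describes the empty tree, which stands above a rule instance at
   the indices that exceed its number of premisses. *)
Definition restricted_tree (l : nat) (p : tree) (root : option sequent) : Prop :=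
  [/\ locally_correct p, Pi_restricted l p, regular p & marking p [::] = root].

Definition derivable (l : nat) (G : sequent) : Prop :=
  exists p, restricted_tree l p (Some G).

Definition empty_tree : tree := fun _ => None.

Lemma restricted_empty_tree l : restricted_tree l empty_tree None.
Proof. by split=> //; [move=> b /(_ 0) | exists [::]]. Qed.

Lemma locally_correct_empty p :
  locally_correct p -> marking p [::] = None -> forall a, p a = None.
Proof.
move=> [_ p_markings] root_None; elim/last_ind=> [|a i IH].
  by move: root_None; rewrite /marking; case: (p _).
by have := p_markings a i; rewrite IH /marking; case: (p _).
Qed.

Lemma restricted_trees_of_seq l (s : seq sequent) :
    (forall G, G \in s -> derivable l G) ->
  exists f : nat -> tree, forall i, restricted_tree l (f i) (onth s i).
Proof.
elim: s => [|G s IH] sP.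
  exists (fun _ => empty_tree) => i; rewrite onth0n.
  exact: restricted_empty_tree.
have [p pG] := sP G (mem_head _ _).
have [|f fP] := IH; first by move=> D Ds; apply: sP; rewrite inE Ds orbT.
by exists (fun i => if i is j.+1 then f j else p) => -[|i] //=; apply: fP.
Qed.

Definition join_tree (r : rule) (f : nat -> tree) : tree :=
  fun a => if a is i :: a' then f i a' else Some r.

Lemma locally_correct_join r f :
    side_condition r -> (forall i, locally_correct (f i)) ->
    (forall i, marking (f i) [::] = onth (premisses r) i) ->
  locally_correct (join_tree r f).
Proof.
move=> r_side f_correct f_root; split.
  by case=> [|i a] r' /=; [case=> <- | apply: (f_correct i).1].
by case=> [|i a] j /=; [apply: f_root | apply: (f_correct i).2].
Qed.

Lemma Pi_restricted_join l r f :
  (forall i, Pi_restricted l (f i)) -> Pi_restricted l (join_tree r f).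
Proof.
by move=> f_res b; apply: (@restricted_branch_subtree l _ (f (b 0)) b 1).
Qed.

Lemma regular_join r f n :
    (forall i, regular (f i)) -> (forall i, n <= i -> forall a, f i a = None) ->
  regular (join_tree r f).
Proof.
move=> f_reg f_empty.
have [s sP] : exists s : seq (seq nat), forall i a, i < n -> f i a <> None ->
    exists2 c, c \in s &
      forall d, marking (f i) (a ++ d) = marking (join_tree r f) (c ++ d).
  elim: (n) => [|m [s sP]]; first by exists [::].
  have [t tP] := f_reg m; exists ([seq m :: c | c <- t] ++ s) => i a.
  rewrite ltnS leq_eqVlt => /orP[/eqP-> /tP[c tc cE]|im /(sP _ _ im)[c sc cE]].
    by exists (m :: c); rewrite // mem_cat map_f.
  by exists c; rewrite // mem_cat sc orbT.
exists ([::] :: s) => -[|i a] /= ia; first by exists [::].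
have [lt_in|/f_empty f_i_empty] := ltnP i n; last by rewrite f_i_empty in ia.
by have [c sc cE] := sP i a lt_in ia; exists c; rewrite // inE sc orbT.
Qed.

Lemma derivable_rule l r :
    side_condition r -> (forall G, G \in premisses r -> derivable l G) ->
  derivable l (conclusion r).
Proof.
move=> r_side /restricted_trees_of_seq[f f_tree]; exists (join_tree r f).
have f_correct i : locally_correct (f i) by case: (f_tree i).
have f_root i : marking (f i) [::] = onth (premisses r) i by case: (f_tree i).
split=> //.
- exact: locally_correct_join.
- by apply: Pi_restricted_join => i; case: (f_tree i).
- apply: (@regular_join _ _ (size (premisses r))) => i; first by case: (f_tree i).
  by move=> le_i; apply: locally_correct_empty; rewrite // f_root onth_default.
Qed.

(** * Negation, substitution and fresh variables *)

Lemma negK : involutive neg.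
Proof. by elim=> //= [a -> b ->|a -> b ->|y a ->|y a ->]. Qed.

Lemma fv_neg phi : fv (neg phi) = fv phi.
Proof. by elim: phi => //= [a -> b ->|a -> b ->|y a ->|y a ->]. Qed.

Lemma neg_subst y t phi : neg (subst y t phi) = subst y t (neg phi).
Proof.
by elim: phi => //= [a -> b ->|a -> b ->|x a|x a] //; case: eqP => //= _ ->.
Qed.

Lemma free_for_neg y t phi : free_for y t (neg phi) = free_for y t phi.
Proof.
by elim: phi => //= [a -> b ->|a -> b ->|x a|x a] //; rewrite fv_neg => ->.
Qed.

Lemma notin_fv_All y phi : y \notin fv (All y phi).
Proof. by rewrite /= mem_filter eqxx. Qed.

Lemma tsubst_id y t u : y \notin tvars u -> tsubst y t u = u.
Proof.
elim: u => //= [x|u IH|u IHu v IHv|u IHu v IHv].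
- by rewrite inE eq_sym => /negPf->.
- by move/IH->.
- by rewrite mem_cat => /norP[/IHu-> /IHv->].
- by rewrite mem_cat => /norP[/IHu-> /IHv->].
Qed.

Lemma subst_id y t phi : y \notin fv phi -> subst y t phi = phi.
Proof.
elim: phi => //= [u v|u v|a IHa b IHb|a IHa b IHb|x a IH|x a IH].
1,2: by rewrite mem_cat => /norP[yu yv]; rewrite !tsubst_id.
1,2: by rewrite mem_cat => /norP[/IHa-> /IHb->].
all: by rewrite mem_filter eq_sym; case: eqP => //= _ /IH->.
Qed.

Lemma tsubst_var y u : tsubst y (Var y) u = u.
Proof.
by elim: u => //= [x|u ->|u -> v ->|u -> v ->] //; case: eqP => // ->.
Qed.

Lemma subst_var y phi : subst y (Var y) phi = phi.
Proof.
elim: phi => //= [u v|u v|a -> b ->|a -> b ->|x a ->|x a ->] //;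
  by rewrite ?tsubst_var ?if_same.
Qed.

Lemma tvars_tsubst v x t u :
  v \in tvars (tsubst x t u) -> (v != x) && (v \in tvars u) || (v \in tvars t).
Proof.
elim: u => //= [y|u IHu w IHw|u IHu w IHw].
- have [_ ->|yx /=] := eqVneq y x; first by rewrite orbT.
  by rewrite !inE => /eqP->; rewrite yx eqxx.
- by rewrite !mem_cat => /orP[/IHu|/IHw] /orP[/andP[-> ->]|->]; rewrite ?orbT.
- by rewrite !mem_cat => /orP[/IHu|/IHw] /orP[/andP[-> ->]|->]; rewrite ?orbT.
Qed.

Lemma fv_subst v x t phi :
  v \in fv (subst x t phi) -> (v != x) && (v \in fv phi) || (v \in tvars t).
Proof.
elim: phi => //= [u w|u w|a IHa b IHb|a IHa b IHb|y a IH|y a IH].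
1,2: rewrite !mem_cat => /orP[]/tvars_tsubst /orP[/andP[-> ->]|->];
       by rewrite ?orbT.
1,2: by rewrite !mem_cat => /orP[/IHa|/IHb] /orP[/andP[-> ->]|->]; rewrite ?orbT.
all: case: eqP => [-> /=|_ /=]; rewrite !mem_filter.
1,3: by case/andP=> -> ->.
all: by case/andP=> -> /IH /orP[/andP[-> ->]|->]; rewrite ?orbT.
Qed.

Lemma notin_fv_subst x t phi : x \notin tvars t -> x \notin fv (subst x t phi).
Proof. by move=> xt; apply/negP => /fv_subst; rewrite eqxx (negPf xt). Qed.

Lemma notin_fv_subst_fresh v x t phi :
  v \notin fv phi -> v \notin tvars t -> v \notin fv (subst x t phi).
Proof.
by move=> vphi vt; apply/negP => /fv_subst; rewrite (negPf vphi) (negPf vt) andbF.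
Qed.

Lemma free_for_notin_fv y t phi : y \notin fv phi -> free_for y t phi.
Proof.
elim: phi => //= [a IHa b IHb|a IHa b IHb|x a _ ->|x a _ ->] //.
all: by rewrite mem_cat => /norP[/IHa-> /IHb->].
Qed.

Lemma tsubst_comm x t y u v :
    x != y -> y \notin tvars t -> x \notin tvars u ->
  tsubst x t (tsubst y u v) = tsubst y u (tsubst x t v).
Proof.
move=> xy yt xu; elim: v => //= [w|v ->|v -> w ->|v -> w ->] //.
have [->|wy] := eqVneq w y; first by rewrite eq_sym (negPf xy) /= eqxx tsubst_id.
have [->|wx] /= := eqVneq w x; first by rewrite eqxx tsubst_id.
by rewrite (negPf wx) (negPf wy).
Qed.

Lemma subst_comm x t y u phi :
    x != y -> y \notin tvars t -> x \notin tvars u ->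
  subst x t (subst y u phi) = subst y u (subst x t phi).
Proof.
move=> xy yt xu.
elim: phi => //= [v w|v w|a -> b ->|a -> b ->|w a IH|w a IH] //.
1,2: by rewrite !(tsubst_comm _ xy).
all: have [->|wy] := eqVneq w y; first by rewrite /= eq_sym (negPf xy) /= eqxx.
all: have [->|wx] /= := eqVneq w x; first by rewrite eqxx (negPf xy).
all: by rewrite (negPf wx) (negPf wy) IH.
Qed.

Lemma free_for_self y t phi : {subset tvars t <= [:: y]} -> free_for y t phi.
Proof.
move=> ty; elim: phi => //= [a -> b ->|a -> b ->|x a ->|x a ->] //.
all: rewrite mem_filter andbT; have [->|xy] := eqVneq y x => //=.
all: by apply/orP; right; apply/negP => /ty; rewrite inE eq_sym (negPf xy).
Qed.

Lemma free_for_subst y u x t phi :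
  y \notin tvars t -> free_for y u phi -> free_for y u (subst x t phi).
Proof.
move=> yt; elim: phi => //= [a IHa b IHb|a IHa b IHb|w a IH|w a IH].
1,2: by case/andP=> /IHa-> /IHb->.
all: case: ifP => //= wx /orP[y_fv|/andP[-> /IH->]]; last by rewrite orbT.
all: apply/orP; left; apply: contra y_fv; rewrite !mem_filter.
all: by case/andP=> -> /fv_subst; rewrite (negPf yt) orbF => /andP[].
Qed.

Fixpoint vars (phi : formula) : seq nat :=
  match phi with
  | Eq t u | Neq t u => tvars t ++ tvars u
  | And a b | Or a b => vars a ++ vars b
  | All y a | Ex y a => y :: vars a
  end.

Lemma fv_vars phi : {subset fv phi <= vars phi}.
Proof.
elim: phi => [t u|t u|a IHa b IHb|a IHa b IHb|y a IH|y a IH] v //=.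
1,2: by rewrite !mem_cat => /orP[/IHa|/IHb]->; rewrite ?orbT.
all: by rewrite mem_filter inE => /andP[_ /IH->]; rewrite orbT.
Qed.

Lemma notin_fv z phi : z \notin vars phi -> z \notin fv phi.
Proof. exact/contra/fv_vars. Qed.

Lemma free_for_new y z phi : z \notin vars phi -> free_for y (Var z) phi.
Proof.
elim: phi => //= [a IHa b IHb|a IHa b IHb|x a IH|x a IH].
1,2: by rewrite mem_cat => /norP[/IHa-> /IHb->].
all: by rewrite !inE eq_sym => /norP[-> /IH->]; rewrite orbT.
Qed.

Definition fresh (z : nat) (G : seq formula) : bool :=
  all (fun phi => z \notin fv phi) G.

Lemma freshP z G : reflect (forall phi, phi \in G -> z \notin fv phi) (fresh z G).
Proof. exact: allP. Qed.

Lemma fresh_cons z phi G : fresh z (phi :: G) = (z \notin fv phi) && fresh z G.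
Proof. by []. Qed.

Lemma fresh_map_neg z G : fresh z (map neg G) = fresh z G.
Proof. by rewrite /fresh all_map; apply: eq_all => phi /=; rewrite fv_neg. Qed.

Lemma map_subst_fresh z t G : fresh z G -> [seq subst z t phi | phi <- G] = G.
Proof. by elim: G => //= phi G IH /andP[/subst_id-> /IH->]. Qed.

Lemma exists_notin (s : seq nat) : exists z, z \notin s.
Proof.
suff le v : v \in s -> v <= sumn s.
  by exists (sumn s).+1; apply/negP => /le; rewrite ltnn.
elim: s => //= w s IH; rewrite inE => /orP[/eqP->|/IH]; first exact: leq_addr.
by move/leq_trans; apply; apply: leq_addl.
Qed.

Lemma exists_new_var (s : seq nat) (G : seq formula) :
  exists2 z, z \notin s & forall phi, phi \in G -> z \notin vars phi.
Proof.
have [z] := exists_notin (s ++ flatten (map vars G)).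
rewrite mem_cat => /norP[zs zG]; exists z => // phi Gphi.
by apply: contra zG => zphi; apply/flatten_mapP; exists phi.
Qed.

Fixpoint fsize (phi : formula) : nat :=
  match phi with
  | Eq _ _ | Neq _ _ => 0
  | And a b | Or a b => (fsize a + fsize b).+1
  | All _ a | Ex _ a => (fsize a).+1
  end.

Lemma fsize_subst y t phi : fsize (subst y t phi) = fsize phi.
Proof.
elim: phi => //= [a -> b ->|a -> b ->|x a IH|x a IH] //.
all: by case: ifP => //= _; rewrite IH.
Qed.

Lemma fsize_neg phi : fsize (neg phi) = fsize phi.
Proof. by elim: phi => //= [a -> b ->|a -> b ->|y a ->|y a ->]. Qed.

Lemma formula_dual_ind (P : formula -> Prop) :
    (forall phi, P phi -> P (neg phi)) ->
    (forall t u, P (Eq t u)) ->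
    (forall a b, P a -> P b -> P (And a b)) ->
    (forall y a, (forall t, P (subst y t a)) -> P (All y a)) ->
  forall phi, P phi.
Proof.
move=> P_neg P_Eq P_And P_All phi.
have [m] := ubnP (fsize phi); elim: m phi => // m IH.
case=> [t u|t u|a b|a b|y a|y a] /= lt_m.
- exact: P_Eq.
- exact: (P_neg (Eq t u)).
- by apply: P_And; apply: IH; lia.
- rewrite -[Or a b]negK; apply: P_neg.
  by apply: P_And; apply: IH; rewrite fsize_neg; lia.
- by apply: P_All => t; apply: IH; rewrite fsize_subst.
- rewrite -[Ex y a]negK; apply: P_neg.
  by apply: P_All => t; apply: IH; rewrite fsize_subst fsize_neg.
Qed.

Lemma Delta0_neg phi : Delta0 phi -> Delta0 (neg phi).
Proof. by elim=> /=; constructor. Qed.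

Lemma Sigma_Pi_neg n :
  (forall phi, Sigma n phi -> Pi n (neg phi)) /\
  (forall phi, Pi n phi -> Sigma n (neg phi)).
Proof.
elim: n => [|n [IHS IHP]]; first by split; apply: Delta0_neg.
by split=> phi /=; elim=> /= *; constructor; auto.
Qed.

Lemma Delta0_Sigma_Pi n phi : Delta0 phi -> Sigma n phi /\ Pi n phi.
Proof.
move=> phi0; elim: n => //= n [IHS IHP].
by split; [apply: ex_base | apply: all_base].
Qed.

Lemma Delta0_Pi n phi : Delta0 phi -> Pi n phi.
Proof. by case/(Delta0_Sigma_Pi n). Qed.

Lemma Sigma_neg n phi : Sigma n phi -> Pi n (neg phi).
Proof. exact: (Sigma_Pi_neg n).1. Qed.

Lemma mem_seq_mset (G : seq formula) phi : (phi \in seq_mset G) = (phi \in G).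
Proof. exact/perm_mem/perm_eq_seq_mset. Qed.

Lemma msetD_seq1 (G : seq formula) a :
  seq_mset G `+` [mset a] = seq_mset (a :: G).
Proof. by rewrite mset_cons msetDC. Qed.

Lemma msetD_seq2 (G : seq formula) a b :
  seq_mset G `+` [mset a; b] = seq_mset [:: a, b & G].
Proof. by rewrite !mset_cons msetDC msetDA. Qed.

Lemma msetD_seq3 (G : seq formula) a b c :
  seq_mset G `+` [mset a; b; c] = seq_mset [:: a, b, c & G].
Proof. by rewrite !mset_cons msetDC !msetDA. Qed.

Definition msetD_seq := (msetD_seq1, msetD_seq2, msetD_seq3).

Lemma seq_subst_seq_mset y t G :
  seq_subst y t (seq_mset G) = seq_mset [seq subst y t phi | phi <- G].
Proof. exact/eq_seq_msetP/perm_map/perm_eq_seq_mset. Qed.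

Lemma in_fv_seq_mset z G : in_fv z (seq_mset G) <-> ~~ fresh z G.
Proof.
rewrite /fresh -has_predC; split=> [[phi]|/hasP[phi Gphi]].
  rewrite mem_seq_mset => Gphi zphi.
  by apply/hasP; exists phi => //=; rewrite negbK.
by rewrite /= negbK => zphi; exists phi; rewrite ?mem_seq_mset.
Qed.

Lemma seq_subst_msetD1 x t (G : sequent) phi :
  ~ in_fv x G -> seq_subst x t (G `+` [mset phi]) = G `+` [mset subst x t phi].
Proof.
rewrite -(seq_mset_id G) in_fv_seq_mset => /negP/negbNE xG.
by rewrite !msetD_seq seq_subst_seq_mset /= map_subst_fresh.
Qed.

(** * The cyclic proof of induction *)

Section CyclicInduction.

Variables (l : nat) (G : sequent) (x : nat) (phi : formula) (base step : tree).

Let phi_succ : formula := subst x (Succ (Var x)) phi.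

Fixpoint induction_tree (a : seq nat) : option rule :=
  match a with
  | [::] => Some (RCase (G `+` [mset phi]) x)
  | 0 :: a' => base a'
  | [:: 1] => Some (RCut (G `+` [mset phi_succ]) phi)
  | [:: 1; 0] => Some (RWeak (G `+` [mset phi]) [mset phi_succ])
  | 1 :: 0 :: 0 :: a' => induction_tree a'
  | 1 :: 1 :: a' => step a'
  | _ => None
  end.

Let cycle : seq nat := [:: 1; 0; 0].

Lemma induction_tree_ind (P : seq nat -> Prop) :
    P [::] -> (forall a, P (0 :: a)) -> P [:: 1] -> P [:: 1; 0] ->
    (forall a, P a -> P (cycle ++ a)) -> (forall a, P [:: 1, 1 & a]) ->
    (forall a, (forall d, induction_tree (a ++ d) = None) -> P a) ->
  forall a, P a.
Proof.
move=> P_root P_base P_cut P_weak P_cycle P_step P_None a.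
have [m] := ubnP (size a); elim: m a => // m IH [//|[|[|i]] a] /= lt_m.
- exact: P_base.
- case: a lt_m => [//|[|[|i]] a] /=; last by move=> _; apply: P_None.
    case: a => [//|[|i] a] /= lt_m; last exact: P_None.
    by apply/P_cycle/IH; lia.
  by move=> _; apply: P_step.
- exact: P_None.
Qed.

Hypotheses (Pi_phi : Pi l phi) (x_fresh : ~ in_fv x G) (x_phi : x \in fv phi).
Hypothesis base_tree :
  restricted_tree l base (Some (G `+` [mset subst x Zero phi])).
Hypothesis step_tree :
  restricted_tree l step (Some (G `+` [mset phi_succ] `+` [mset neg phi])).

Lemma locally_correct_induction : locally_correct induction_tree.
Proof.
have [[base_side base_mark] _ _ base_root] := base_tree.
have [[step_side step_mark] _ _ step_root] := step_tree.
split.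
  elim/induction_tree_ind=> [r [<-]|a r|r [<-]|r [<-]|a IH r|a r|a aN r] //=.
  - by exists phi; rewrite // in_msetD in_mset1 eqxx orbT.
  - exact: base_side.
  - exact: IH.
  - exact: step_side.
  - by have := aN [::]; rewrite cats0 => ->.
elim/induction_tree_ind=> [|a|||a IH|a|a aN] i.
- by case: i => [|[|i]] //=; rewrite /marking /= ?seq_subst_msetD1 ?onth0n.
- exact: base_mark.
- by case: i => [|[|i]] //=; rewrite /marking /= ?onth0n // msetDAC.
- by case: i => [|i]; rewrite /marking /= ?onth0n.
- exact: IH.
- exact: step_mark.
- by rewrite -cats1 /marking aN; have := aN [::]; rewrite cats0 => ->.
Qed.

Lemma regular_induction : regular induction_tree.
Proof.
have [_ _ [s0 s0P] _] := base_tree; have [_ _ [s1 s1P] _] := step_tree.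
exists ([:: [::]; [:: 1]; [:: 1; 0]] ++ [seq 0 :: c | c <- s0]
        ++ [seq [:: 1; 1] ++ c | c <- s1]).
elim/induction_tree_ind=> [|a|||a IH|a|a].
- by exists [::].
- by case/s0P=> c sc cE; exists (0 :: c) => //; rewrite !mem_cat map_f ?orbT.
- by exists [:: 1].
- by exists [:: 1; 0].
- by case/IH=> c; exists c.
- case/s1P=> c sc cE; exists ([:: 1; 1] ++ c) => //.
  by rewrite !mem_cat (map_f (cat _)) ?orbT.
- by move/(_ [::]); rewrite cats0.
Qed.

Lemma induction_cycle_step k :
  branch_step induction_tree (periodic_branch cycle) k =
    nth (None, 0)
        [:: (Some (RCase (G `+` [mset phi]) x), 1);
            (Some (RCut (G `+` [mset phi_succ]) phi), 0);
            (Some (RWeak (G `+` [mset phi]) [mset phi_succ]), 0)] (k %% 3).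
Proof.
rewrite /branch_step -[mkseq _ k]cats0 periodic_node // cats0 /periodic_branch /=.
by case: (k %% 3) (ltn_pmod k (isT : 0 < 3)) => [|[|[|]]].
Qed.

Lemma restricted_induction_cycle :
  restricted_branch l induction_tree (periodic_branch cycle).
Proof.
have cycle_passes k r i :
    passes induction_tree (periodic_branch cycle) k r i ->
    [\/ r = RCase (G `+` [mset phi]) x /\ i = 1,
        r = RCut (G `+` [mset phi_succ]) phi /\ i = 0 |
        r = RWeak (G `+` [mset phi]) [mset phi_succ] /\ i = 0].
  case=> node_k b_k; have := induction_cycle_step k.
  rewrite /branch_step node_k b_k.
  case: (k %% 3) (ltn_pmod k (isT : 0 < 3)) => [|[|[|//]]] _ [-> ->].
  - exact: Or31.
  - exact: Or32.
  - exact: Or33.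
exists 0; split; first split.
- by move=> k D y _ /cycle_passes[] [].
- move=> k D z _ _ j D' y psi _ node_j.
  by case: (cycle_passes j _ _ (conj node_j erefl)) => [] [].
- exists x => N; exists (N * 3), (G `+` [mset phi]); split=> //.
    by rewrite leq_pmulr.
  by have := induction_cycle_step (N * 3); rewrite modnMl => -[].
move=> k _; split.
- by move=> D psi chi; split=> /cycle_passes[] [].
- move=> D y psi z node_k.
  by case: (cycle_passes k _ _ (conj node_k erefl)) => [] [].
- by move=> D psi; split=> /cycle_passes[] [] // [_ ->].
- move=> D z /cycle_passes[] [] // [-> ->] _ psi.
  rewrite in_msetD in_mset1 => /orP[G_psi x_psi|/eqP-> //].
  by case: x_fresh; exists psi.
Qed.

Lemma Pi_restricted_induction : Pi_restricted l induction_tree.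
Proof.
have [_ base_res _ _] := base_tree; have [_ step_res _ _] := step_tree.
apply: (@periodic_Pi_restricted _ cycle) => //.
  exact: restricted_induction_cycle.
have empty_res : Pi_restricted l empty_tree by move=> b /(_ 0).
by case=> [|[|[|//]]] [|[|i]].
Qed.

Lemma restricted_induction_tree :
  restricted_tree l induction_tree (Some (G `+` [mset phi])).
Proof.
split=> //; first exact: locally_correct_induction.
- exact: Pi_restricted_induction.
- exact: regular_induction.
Qed.

End CyclicInduction.

Lemma derivable_induction l (G : sequent) x phi :
    Pi l phi -> ~ in_fv x G ->
    derivable l (G `+` [mset subst x Zero phi]) ->
    derivable l (G `+` [mset subst x (Succ (Var x)) phi] `+` [mset neg phi]) ->
  derivable l (G `+` [mset phi]).
Proof.
move=> Pi_phi xG base step.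
have [x_phi|x_phi] := boolP (x \in fv phi); last first.
  by rewrite subst_id in base.
have [p p_tree] := base; have [q q_tree] := step.
by exists (induction_tree G x phi p q); apply: restricted_induction_tree.
Qed.

(** * Natural deduction in SQ *)

Section Calculus.

Variable l : nat.

Implicit Type G : seq formula.

Definition derives (G : seq formula) : Prop := derivable l (seq_mset G).

Lemma derives_perm G D : perm_eq G D -> derives G -> derives D.
Proof. by rewrite /derives => /eq_seq_msetP->. Qed.

Ltac permute := apply: derives_perm; apply/permP => ? /=; lia.

Lemma derives_swap a b G : derives [:: a, b & G] -> derives [:: b, a & G].
Proof. permute. Qed.

Lemma derives_rule r G (Ds : seq (seq formula)) :
    conclusion r = seq_mset G -> side_condition r ->
    premisses r = map (@seq_mset _) Ds -> (forall D, D \in Ds -> derives D) ->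
  derives G.
Proof.
rewrite /derives => <- r_side r_premisses Ds_der; apply: derivable_rule => // D.
by rewrite r_premisses => /mapP[D' /Ds_der ? ->].
Qed.

Lemma derives_initial r G :
    conclusion r = seq_mset G -> side_condition r -> premisses r = [::] ->
  derives G.
Proof. by move=> concl side prem; apply: (@derives_rule r G [::]). Qed.

Lemma derives_unary r D G :
    conclusion r = seq_mset G -> side_condition r ->
    premisses r = [:: seq_mset D] -> derives D ->
  derives G.
Proof.
move=> concl side prem D_der; apply: (@derives_rule r G [:: D]) => // E.
by rewrite inE => /eqP->.
Qed.

Lemma derives_binary r D D' G :
    conclusion r = seq_mset G -> side_condition r ->
    premisses r = [:: seq_mset D; seq_mset D'] -> derives D -> derives D' ->
  derives G.
Proof.
move=> concl side prem D_der D'_der.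
apply: (@derives_rule r G [:: D; D']) => // E.
by rewrite !inE => /orP[]/eqP->.
Qed.

Lemma derives_weak a G : derives G -> derives (a :: G).
Proof.
by apply: (@derives_unary (RWeak (seq_mset G) [mset a])); rewrite //= msetD_seq.
Qed.

Lemma derives_cut a G : derives (a :: G) -> derives (neg a :: G) -> derives G.
Proof.
by apply: (@derives_binary (RCut (seq_mset G) a)); rewrite //= !msetD_seq.
Qed.

Lemma derives_Eq_Neq t u G : derives [:: Eq t u, Neq t u & G].
Proof.
by apply: (@derives_initial (InitEq (seq_mset G) t u)); rewrite //= msetD_seq.
Qed.

Lemma derives_Succ_neq0 t G : derives (Neq (Succ t) Zero :: G).
Proof.
by apply: (@derives_initial (InitSucc (seq_mset G) t)); rewrite //= msetD_seq.
Qed.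

Lemma derives_And a b G :
  derives (a :: G) -> derives (b :: G) -> derives (And a b :: G).
Proof.
by apply: (@derives_binary (RAnd (seq_mset G) a b)); rewrite //= !msetD_seq.
Qed.

Lemma derives_Or a b G : derives [:: a, b & G] -> derives (Or a b :: G).
Proof.
by apply: (@derives_unary (ROr (seq_mset G) a b)); rewrite //= !msetD_seq.
Qed.

Lemma derives_All z y a G :
    fresh z (All y a :: G) -> free_for y (Var z) a ->
  derives (subst y (Var z) a :: G) -> derives (All y a :: G).
Proof.
move=> z_fresh ff.
apply: (@derives_unary (RAll (seq_mset G) y a z)); rewrite //= !msetD_seq //.
by split=> //; rewrite in_fv_seq_mset z_fresh.
Qed.

Lemma derives_Ex t y a G :
    free_for y t a -> derives [:: subst y t a, Ex y a & G] ->
  derives (Ex y a :: G).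
Proof.
move=> ff; apply: (@derives_unary (REx (seq_mset G) y a t));
  by rewrite //= !msetD_seq.
Qed.

Lemma derives_ref t G : derives (Neq t t :: G) -> derives G.
Proof.
by apply: (@derives_unary (RRef (seq_mset G) t)); rewrite //= msetD_seq.
Qed.

Lemma derives_rep y u0 u1 t0 t1 G (u01 := Neq u0 u1) :
    derives [:: Neq t0 t1, subst y t0 u01, subst y t1 u01 & G] ->
  derives [:: Neq t0 t1, subst y t0 u01 & G].
Proof.
apply: (@derives_unary (RRep (seq_mset G) t0 t1 y u0 u1));
  by rewrite //= msetD_seq.
Qed.

Lemma derives_pred t u G :
  derives [:: Neq (Succ t) (Succ u), Neq t u & G] ->
  derives (Neq (Succ t) (Succ u) :: G).
Proof.
by apply: (@derives_unary (RPred (seq_mset G) t u)); rewrite //= msetD_seq.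
Qed.

Lemma derives_case x G :
    ~~ fresh x G -> derives [seq subst x Zero phi | phi <- G] ->
    derives [seq subst x (Succ (Var x)) phi | phi <- G] ->
  derives G.
Proof.
move=> /in_fv_seq_mset x_G.
apply: (@derives_binary (RCase (seq_mset G) x));
  by rewrite //= ?seq_subst_seq_mset.
Qed.

Lemma derives_Eq_of_rule (r : sequent -> rule) t u G :
    (forall D, [/\ conclusion (r D) = D, side_condition (r D)
                 & premisses (r D) = [:: D `+` [mset Neq t u]]]) ->
  derives (Eq t u :: G).
Proof.
move=> /(_ (seq_mset (Eq t u :: G)))[concl side prem].
apply: derives_unary concl side _ _; first by rewrite prem msetD_seq.
exact/derives_swap/derives_Eq_Neq.
Qed.

Lemma derives_refl t G : derives (Eq t t :: G).
Proof. exact: (@derives_Eq_of_rule (RRef^~ t)). Qed.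

Lemma derives_Add0 t G : derives (Eq (Add t Zero) t :: G).
Proof. exact: (@derives_Eq_of_rule (RAdd0^~ t)). Qed.

Lemma derives_AddS t u G : derives (Eq (Add t (Succ u)) (Succ (Add t u)) :: G).
Proof. exact: (@derives_Eq_of_rule (fun D => RAddS D t u)). Qed.

Lemma derives_Mul0 t G : derives (Eq (Mul t Zero) Zero :: G).
Proof. exact: (@derives_Eq_of_rule (RMult0^~ t)). Qed.

Lemma derives_MulS t u G :
  derives (Eq (Mul t (Succ u)) (Add (Mul t u) t) :: G).
Proof. exact: (@derives_Eq_of_rule (fun D => RMultS D t u)). Qed.

Lemma derives_And_Or a b c d G :
    derives [:: a, c & G] -> derives [:: b, d & G] ->
  derives [:: And a b, Or c d & G].
Proof.
move=> ac bd; apply/derives_swap/derives_Or.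
suff: derives [:: And a b, c, d & G] by permute.
apply: derives_And; first by have := derives_weak d ac; permute.
by have := derives_weak c bd; permute.
Qed.

Lemma derives_All_Ex (avoid : seq nat) x a b G :
    (forall z, z \notin avoid ->
       derives [:: subst x (Var z) a, subst x (Var z) b & G]) ->
  derives [:: All x a, Ex x b & G].
Proof.
move=> ab_z.
have [z z_avoid z_new] := exists_new_var avoid [:: All x a, Ex x b & G].
have /norP[_ za] : z \notin vars (All x a) by apply/z_new/mem_head.
have /norP[_ zb] : z \notin vars (Ex x b).
  by apply: z_new; rewrite !inE eqxx orbT.
apply: (@derives_All z); last 1 first.
- apply/derives_swap/(@derives_Ex (Var z)); first exact: free_for_new.
  by have := derives_weak (Ex x b) (ab_z z z_avoid); permute.
- by apply/freshP => c /z_new; apply: notin_fv.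
- exact: free_for_new.
Qed.

Lemma derives_identity phi G : derives [:: phi, neg phi & G].
Proof.
elim/formula_dual_ind: phi G => [a IH|t u|a b IHa IHb|y a IH] G /=.
- by rewrite negK; apply: derives_swap.
- exact: derives_Eq_Neq.
- exact: derives_And_Or.
- by apply: (@derives_All_Ex [::]) => z _; rewrite -neg_subst.
Qed.

Lemma derives_contract a G : a \in G -> derives (a :: G) -> derives G.
Proof.
move=> aG a_der; apply: (@derives_cut a) => //.
apply: (@derives_perm [:: a, neg a & rem a G]); last exact: derives_identity.
have /permP G_perm := perm_to_rem aG.
by apply/permP => P; rewrite /= G_perm /=; lia.
Qed.

Lemma derives_catr D G : derives G -> derives (G ++ D).
Proof.
move=> G_der; elim: D => [|a D IH]; first by rewrite cats0.
have := derives_weak a IH; apply: derives_perm.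
by rewrite perm_sym -(cat1s a D) perm_catCA.
Qed.

Lemma derives_sub G D : {subset G <= D} -> derives G -> derives D.
Proof.
move=> sub /(derives_catr D); elim: G sub => //= a G IH sub a_der.
apply: IH => [b bG|].
  by rewrite sub // inE bG orbT.
by apply: derives_contract a_der; rewrite mem_cat sub ?orbT ?mem_head.
Qed.

Ltac subseteq :=
  let phi := fresh in
  move=> phi; rewrite ?inE; repeat (case: (phi == _) => //=); rewrite ?orbT //.

Ltac weaken sub_der := apply: derives_sub sub_der; subseteq.

Lemma derives_complementary phi G : phi \in G -> neg phi \in G -> derives G.
Proof.
move=> phiG nphiG; apply: (@derives_sub [:: phi; neg phi]).
  by move=> psi; rewrite !inE => /orP[]/eqP->.
exact: derives_identity.
Qed.

Ltac complementary phi :=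
  by apply: (@derives_complementary phi); rewrite /= !inE ?eqxx ?orbT.

Lemma derives_mp phi psi G :
  derives (phi :: G) -> derives [:: neg phi, psi & G] -> derives (psi :: G).
Proof.
by move=> phi_der; apply: derives_cut; weaken phi_der.
Qed.

Lemma derives_AndEl a b G : derives (And a b :: G) -> derives (a :: G).
Proof. by move/derives_mp; apply; apply: derives_Or; complementary a. Qed.

Lemma derives_AndEr a b G : derives (And a b :: G) -> derives (b :: G).
Proof. by move/derives_mp; apply; apply: derives_Or; complementary b. Qed.

Lemma derives_OrE a b c G :
    derives (Or a b :: G) -> derives [:: neg a, c & G] ->
    derives [:: neg b, c & G] ->
  derives (c :: G).
Proof. by move/derives_mp=> mp ? ?; apply: mp; apply: derives_And. Qed.

Lemma derives_AllE t y a G :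
  free_for y t a -> derives (All y a :: G) -> derives (subst y t a :: G).
Proof.
move=> ff /derives_mp; apply; apply: (@derives_Ex t).
  by rewrite free_for_neg.
by rewrite -neg_subst; complementary (subst y t a).
Qed.

Lemma derives_ExE z y a c G :
    fresh z [:: Ex y a, c & G] -> free_for y (Var z) a ->
    derives (Ex y a :: G) -> derives [:: neg (subst y (Var z) a), c & G] ->
  derives (c :: G).
Proof.
move=> /andP[za z_cG] ff /derives_mp mp a_der; apply: mp.
apply: (@derives_All z); last by rewrite -neg_subst.
  by rewrite fresh_cons /= fv_neg za.
by rewrite free_for_neg.
Qed.

Lemma derives_subst x t phi G :
    fresh x G -> free_for x t phi -> derives (phi :: G) ->
  derives (subst x t phi :: G).
Proof.
move=> x_fresh ff phi_der; apply: derives_AllE ff _.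
apply: (@derives_All x); rewrite ?subst_var ?free_for_self //.
by rewrite fresh_cons notin_fv_All.
Qed.

Lemma derives_univ_closure phi :
  derives [:: phi] -> derives [:: univ_closure phi].
Proof.
rewrite /univ_closure => phi_der; elim: undup => //= y s IH.
apply: (@derives_All y); rewrite ?subst_var ?free_for_self //.
by rewrite fresh_cons notin_fv_All.
Qed.

Lemma derives_Neq_sym t u G : derives (Neq u t :: G) -> derives (Neq t u :: G).
Proof.
move=> ut_der; have [y yt] := exists_notin (tvars t).
apply/(@derives_ref t)/derives_swap.
have := @derives_rep y (Var y) t t u G.
rewrite /= eqxx !(tsubst_id _ yt); apply.
by weaken ut_der.
Qed.

Lemma derives_Leibniz y t u phi G :
    free_for y t phi -> free_for y u phi ->
  derives [:: Neq t u, neg (subst y t phi), subst y u phi & G].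
Proof.
elim/formula_dual_ind: phi t u G => [a IH|v w|a b IHa IHb|x a IH] t u G.
- rewrite !free_for_neg -!neg_subst negK => at' au; apply: derives_Neq_sym.
  by weaken (IH u t G au at').
- move=> _ _; apply: (@derives_rep y v w).
  by complementary (subst y u (Eq v w)).
- move=> /= /andP[at' bt] /andP[au bu].
  suff: derives [:: subst y u (And a b), neg (subst y t (And a b)), Neq t u & G].
    by apply: derives_sub; subseteq.
  apply: derives_And_Or.
    by weaken (IHa t u G at' au).
  by weaken (IHb t u G bt bu).
have [y_a|y_a] := boolP (y \in fv (All x a)); last first.
  by move=> _ _; rewrite !(subst_id _ y_a); complementary (All x a).
rewrite /= in y_a *; rewrite y_a => /andP[xt at'] /andP[xu au].
have xy : x != y by move: y_a; rewrite mem_filter eq_sym => /andP[].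
rewrite (negPf xy).
suff: derives [:: All x (subst y u a), Ex x (neg (subst y t a)), Neq t u & G].
  by apply: derives_sub; subseteq.
apply: (@derives_All_Ex [:: y]) => z; rewrite inE eq_sym => yz.
have yz' : y \notin tvars (Var z) by rewrite inE.
rewrite -neg_subst !(subst_comm _ xy) //.
apply: derives_sub (IH (Var z) t u G _ _); first by subseteq.
- exact: free_for_subst.
- exact: free_for_subst.
Qed.

Lemma derives_rewrite y t u phi G :
    free_for y t phi -> free_for y u phi ->
    derives (Eq t u :: G) -> derives (subst y t phi :: G) ->
  derives (subst y u phi :: G).
Proof.
move=> ft fu tu_der t_der; apply: derives_mp tu_der _.
apply: (@derives_cut (subst y t phi)).
  by weaken t_der.
by weaken (derives_Leibniz G ft fu).
Qed.

Lemma nd_derives (T : formula -> Prop) G phi :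
    (forall psi, T psi -> derives [:: psi]) -> nd T G phi ->
  derives (phi :: map neg G).
Proof.
move=> T_der; elim=> {G phi}.
- by move=> G phi /T_der/(derives_catr (map neg G)).
- move=> G phi G_phi; apply: (@derives_complementary phi).
    exact: mem_head.
  by rewrite inE map_f ?orbT.
- by move=> G a b _ a_der _ b_der; apply: derives_And.
- by move=> G a b _; apply: derives_AndEl.
- by move=> G a b _; apply: derives_AndEr.
- by move=> G a b _ a_der; apply: derives_Or; weaken a_der.
- by move=> G a b _ b_der; apply: derives_Or; weaken b_der.
- move=> G a b c _ ab_der _ ac_der _ bc_der; apply: derives_OrE ab_der _ _.
    by weaken ac_der.
  by weaken bc_der.
- move=> G y a z za /freshP z_fresh ff _ a_der; apply: derives_All ff a_der.
  by rewrite fresh_cons fresh_map_neg za.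
- by move=> G y a t ff _; apply: derives_AllE.
- move=> G y a t ff _ a_der; apply: derives_Ex ff _.
  by weaken a_der.
- move=> G y a z c za zc /freshP z_fresh ff _ a_der _ c_der.
  apply: derives_ExE ff a_der _; last by weaken c_der.
  by rewrite !fresh_cons fresh_map_neg za zc.
- move=> G a _ a_der _ na_der; apply: derives_mp a_der _.
  by weaken na_der.
- move=> G a _; rewrite /= negK => a_der; apply: (@derives_ref Zero).
  by weaken a_der.
- by move=> G t; apply: derives_refl.
- by move=> G y a t u ft fu _ tu_der _ t_der; apply: derives_rewrite tu_der t_der.
Qed.

Lemma derives_eq_sym t u G : derives (Eq t u :: G) -> derives (Eq u t :: G).
Proof.
by move/derives_mp; apply; apply: derives_Neq_sym; complementary (Eq u t).
Qed.

Lemma derives_eq_trans u t v G :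
  derives (Eq t u :: G) -> derives (Eq u v :: G) -> derives (Eq t v :: G).
Proof.
move=> tu_der uv_der; have [y yt] := exists_notin (tvars t).
have := @derives_rewrite y u v (Eq t (Var y)) G isT isT uv_der.
by rewrite /= eqxx !(tsubst_id _ yt); apply.
Qed.

Lemma derives_eq_Succ t u G :
  derives (Eq t u :: G) -> derives (Eq (Succ t) (Succ u) :: G).
Proof.
move=> tu_der; have [y yt] := exists_notin (tvars t).
have := @derives_rewrite y t u (Eq (Succ t) (Succ (Var y))) G isT isT tu_der.
by rewrite /= eqxx !(tsubst_id _ yt); apply; apply: derives_refl.
Qed.

(** * Arithmetic and induction *)

Lemma derives_induction x phi G :
    Pi l phi -> fresh x G -> derives (subst x Zero phi :: G) ->
    derives [:: neg phi, subst x (Succ (Var x)) phi & G] ->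
  derives (phi :: G).
Proof.
rewrite /derives -!msetD_seq1 => Pi_phi x_fresh.
by apply: derivable_induction => //; rewrite in_fv_seq_mset x_fresh.
Qed.

Lemma derives_add0l t G : derives (Eq (Add Zero t) t :: G).
Proof.
suff zero_add : derives [:: Eq (Add Zero (Var 0)) (Var 0)].
  apply: (@derives_catr G [:: _]).
  exact: (@derives_subst 0 t (Eq (Add Zero (Var 0)) (Var 0)) [::]).
apply: (@derives_induction 0) => //=; first exact/Delta0_Pi/Delta0_Eq.
  exact: derives_Add0.
apply: derives_swap.
apply: (@derives_eq_trans (Succ (Add Zero (Var 0)))); first exact: derives_AddS.
exact/derives_eq_Succ/derives_Eq_Neq.
Qed.

Lemma derives_addSl t u G :
  derives (Eq (Add (Succ t) u) (Succ (Add t u)) :: G).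
Proof.
have [k kt] := exists_notin (tvars t).
pose e v := Eq (Add (Succ t) v) (Succ (Add t v)).
have eE v : subst k v (e (Var k)) = e v by rewrite /= eqxx !tsubst_id.
suff succ_add : derives [:: e (Var k)].
  by apply: (@derives_catr G [:: e u]); rewrite -eE; apply: derives_subst.
apply: (@derives_induction k) => //; rewrite ?eE.
- exact/Delta0_Pi/Delta0_Eq.
- apply: (@derives_eq_trans (Succ t)); first exact: derives_Add0.
  exact/derives_eq_Succ/derives_eq_sym/derives_Add0.
apply: derives_swap.
apply: (@derives_eq_trans (Succ (Add (Succ t) (Var k)))).
  exact: derives_AddS.
apply: derives_eq_Succ; apply: (@derives_eq_trans (Succ (Add t (Var k)))).
  exact: derives_Eq_Neq.
exact/derives_eq_sym/derives_AddS.
Qed.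

Lemma derives_Q_axiom phi : Q_axiom phi -> derives [:: phi].
Proof.
case=> /=.
- exact: derives_Succ_neq0.
- by apply/derives_Or/derives_pred; complementary (Eq (Var 0) (Var 1)).
- apply: (@derives_case 0) => //=; apply: derives_Or; first exact: derives_refl.
  by apply/derives_swap/(@derives_Ex (Var 0)) => //=; apply: derives_refl.
- exact: derives_Add0.
- exact: derives_AddS.
- exact: derives_Mul0.
- exact: derives_MulS.
Qed.

Definition none_below (x : nat) (phi : formula) (a t : term) : formula :=
  All x (Or (Neq (Add (Var x) t) a) (neg phi)).

Lemma Pi_none_below x phi a t :
  0 < l -> Sigma l phi -> Pi l (none_below x phi a t).
Proof.
case: (l) => // n _ Sigma_phi; apply/all_All/all_Or.
  exact/(@Delta0_Pi n.+1)/Delta0_Neq.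
exact: (@Sigma_neg n.+1).
Qed.

Lemma subst_none_below k x phi a t u :
    k != x -> k \notin tvars a -> k \notin fv phi ->
  subst k u (none_below x phi a t) = none_below x phi a (tsubst k u t).
Proof.
move=> kx ka kphi; rewrite /none_below /= eq_sym (negPf kx) (tsubst_id u ka).
by rewrite subst_id ?fv_neg.
Qed.

Lemma derives_none_below_intro x phi a t G :
    fresh x G -> derives [:: Neq (Add (Var x) t) a, neg phi & G] ->
  derives (none_below x phi a t :: G).
Proof.
move=> x_fresh body_der; apply: (@derives_All x).
- by rewrite fresh_cons notin_fv_All.
- by rewrite free_for_self.
- by rewrite subst_var; apply: derives_Or.
Qed.

Lemma derives_none_below_elim u x phi a t G :
    x \notin tvars a ++ tvars t -> free_for x u phi ->
    derives (Eq (Add u t) a :: G) -> derives (subst x u phi :: G) ->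
  derives (neg (none_below x phi a t) :: G).
Proof.
rewrite mem_cat => /norP[xa xt] ff add_der phi_der.
rewrite /= negK; apply: (@derives_Ex u) => //=; rewrite eqxx !tsubst_id //.
apply: derives_And; first by weaken add_der.
by weaken phi_der.
Qed.

Lemma derives_none_below0 x phi a G :
    x \notin tvars a -> free_for x a phi -> fresh x G ->
  derives [:: none_below x phi a Zero, subst x a phi & G].
Proof.
move=> xa ff x_fresh; apply: derives_none_below_intro.
  by rewrite fresh_cons notin_fv_subst.
have xphi : free_for x (Var x) phi by apply: free_for_self.
have := derives_Leibniz G xphi ff; rewrite subst_var => leibniz.
apply: (@derives_cut (Eq (Var x) a)); last first.
  by weaken leibniz.
apply: (@derives_eq_trans (Add (Var x) Zero)); last exact: derives_Eq_Neq.
exact/derives_eq_sym/derives_Add0.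
Qed.

Lemma derives_none_belowS x phi a t G :
    x \notin tvars a ++ tvars t -> fresh x G ->
    derives [:: neg phi, subst x (Succ (Var x)) phi & G] ->
  derives [:: none_below x phi a (Succ t), neg (none_below x phi a t) & G].
Proof.
move=> x_at x_fresh succ_der; apply: derives_none_below_intro.
  by rewrite fresh_cons fv_neg notin_fv_All.
set sum_neq := Neq _ _.
suff: derives [:: neg (none_below x phi a t), sum_neq, neg phi & G].
  by apply: derives_sub; subseteq.
apply: (@derives_none_below_elim (Succ (Var x))) => //.
- exact: free_for_self.
- apply: (@derives_eq_trans (Succ (Add (Var x) t))).
    exact: derives_addSl.
  apply: (@derives_eq_trans (Add (Var x) (Succ t))); last exact: derives_Eq_Neq.
  exact/derives_eq_sym/derives_AddS.
- by weaken succ_der.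
Qed.

Lemma derives_none_below x phi a t G :
    0 < l -> Sigma l phi -> x \notin tvars a ++ tvars t -> free_for x a phi ->
    fresh x G -> derives [:: neg phi, subst x (Succ (Var x)) phi & G] ->
  derives [:: none_below x phi a t, subst x a phi & G].
Proof.
move=> l_gt0 Sigma_phi; rewrite mem_cat => /norP[xa xt] ff x_fresh succ_der.
have [k k_avoid k_new] := exists_new_var (x :: tvars a) (phi :: G).
move: k_avoid; rewrite inE => /norP[kx ka].
have k_phi : k \notin vars phi by apply/k_new/mem_head.
have noneE u :
    subst k u (none_below x phi a (Var k)) = none_below x phi a u.
  by rewrite subst_none_below ?notin_fv //= eqxx.
have k_fresh : fresh k (subst x a phi :: G).
  rewrite fresh_cons notin_fv_subst_fresh ?notin_fv //.
  by apply/freshP => psi G_psi; apply/notin_fv/k_new; rewrite inE G_psi orbT.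
rewrite -noneE; apply: derives_subst => //.
  by rewrite /= xt free_for_neg free_for_notin_fv ?notin_fv ?orbT.
apply: (@derives_induction k); rewrite ?noneE //; first exact: Pi_none_below.
  exact: derives_none_below0.
apply/derives_swap/derives_none_belowS.
- by rewrite mem_cat negb_or xa inE eq_sym.
- by rewrite fresh_cons notin_fv_subst.
- by weaken succ_der.
Qed.

(* If phi(a) fails then, by derives_none_below, nothing at distance a below a
   satisfies phi, whereas 0 does. *)
Lemma derives_Sigma_induction x phi G :
    0 < l -> Sigma l phi -> fresh x G -> derives (subst x Zero phi :: G) ->
    derives [:: neg phi, subst x (Succ (Var x)) phi & G] ->
  derives (phi :: G).
Proof.
move=> l_gt0 Sigma_phi x_fresh zero_der succ_der.
have [a a_avoid a_new] := exists_new_var [:: x] (phi :: G).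
have xa : x \notin tvars (Var a) ++ tvars (Var a).
  by move: a_avoid; rewrite !inE orbb eq_sym.
have a_phi : a \notin vars phi by apply/a_new/mem_head.
have phi_a : derives (subst x (Var a) phi :: G).
  have none_a := derives_none_below l_gt0 Sigma_phi xa (free_for_new x a_phi)
    x_fresh succ_der.
  apply: derives_cut none_a _; apply: (@derives_none_below_elim Zero) => //.
  - exact: free_for_self.
  - exact: derives_add0l.
  - by weaken zero_der.
rewrite -[phi in phi :: G](subst_var x); apply: derives_AllE.
  exact: free_for_self.
apply: derives_All phi_a; last exact: free_for_new.
apply/freshP => psi; rewrite inE => /orP[/eqP->|G_psi].
  by rewrite /= mem_filter (negPf (notin_fv a_phi)) andbF.
by apply/notin_fv/a_new; rewrite inE G_psi orbT.
Qed.

Lemma derives_induction_axiom x phi :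
  0 < l -> Sigma l phi -> derives [:: induction x phi].
Proof.
move=> l_gt0 Sigma_phi; apply: derives_Or; rewrite /= negK; apply: derives_Or.
set base := neg _; set step := Ex x _.
suff: derives [:: All x phi; base; step] by permute.
have x_fresh : fresh x [:: base; step].
  by rewrite /fresh /base /step /= fv_neg notin_fv_subst //= mem_filter eqxx.
apply: (@derives_All x); rewrite ?free_for_self //.
  by rewrite fresh_cons notin_fv_All.
rewrite subst_var; apply: (@derives_Sigma_induction x) => //.
  exact: derives_identity.
set succ := subst _ _ _.
suff: derives [:: step; neg phi; succ; base] by permute.
apply: (@derives_Ex (Var x)); first exact: free_for_self.
by rewrite subst_var; apply: derives_And; [complementary phi | complementary succ].
Qed.

Lemma ISigma_derives phi : ISigma l phi -> 0 < l -> derives [:: phi].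
Proof.
case=> [psi Q_psi|x psi Sigma_psi] l_gt0; apply: derives_univ_closure.
  exact: derives_Q_axiom.
exact: derives_induction_axiom.
Qed.

End Calculus.

Theorem corollary3p4 (n : nat) (phi : formula) :
  provable (ISigma n.+1) phi -> S_provable n phi.
Proof.
move=> phi_nd.
have [p [[side markings] restricted reg root]] : derives n.+1 [:: phi].
  by apply: nd_derives phi_nd => psi /ISigma_derives; apply.
exists p; split=> //; last first.
  by rewrite root -[[mset phi]]seq_mset_id enum_msetn.
split; last by move=> b /restricted[m []]; exists m.
by split=> // p_root; rewrite /marking p_root in root.
Qed.
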